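(* Let $r,s,p,q$ be nonnegative integers and set $$m=r+s,\quad n=p+q,\quad M=m+\sigma(n),\quad N=\left[\tfrac{n}{2}\right],\quad t=(p-q)\bmod 8\in\{0,1,\dots,7\},$$ where $[\frac n2]$ is the integer part of $\frac n2$ and $\sigma(n)=n-2[\frac n2]$ (so $\sigma(n)=0$ for even $n$ and $\sigma(n)=1$ for odd $n$). Then the extended Clifford algebra $\mathcal{C}\!\ell(r,s|p,q)$ is isomorphic, as a real algebra, to the following tensor product (with these values of $M$ and $N$): (I) if $r=0$, $s=0$ and $t\in\{0,2\}$: $\ \mathcal{C}\!\ell(r,s|p,q)\simeq\mathcal{C}\!\ell(1,1)^{N}$; (II) if $r=0$, $s=0$ and $t\in\{4,6\}$: $\ N\ge 1$ and $\mathcal{C}\!\ell(r,s|p,q)\simeq\mathcal{C}\!\ell(0,2)\otimes\mathcal{C}\!\ell(1,1)^{N-1}$; (III) if either $r\ge 0$, $s\ge 1$ and $t\in\{0,1,2,3,4,5,6,7\}$, or $r\ge 0$, $s=0$ and $t\in\{3,7\}$: $\ \mathcal{C}\!\ell(r,s|p,q)\simeq\mathcal{C}\!\ell(0,1)^{M}\otimes\mathcal{C}\!\ell(1,1)^{N}$; (IV) if either $r\ge 0$, $s=0$ and $t=1$, or $r\ge 1$, $s=0$ and $t\in\{0,2\}$: $\ \mathcal{C}\!\ell(r,s|p,q)\simeq\mathcal{C}\!\ell(1,0)^{M}\otimes\mathcal{C}\!\ell(1,1)^{N}$; (V) if either $r\ge 0$, $s=0$ and $t=5$, or $r\ge 1$,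 $s=0$ and $t\in\{4,6\}$: $\ N\ge 1$ and $\mathcal{C}\!\ell(r,s|p,q)\simeq\mathcal{C}\!\ell(1,0)^{M}\otimes\mathcal{C}\!\ell(0,2)\otimes\mathcal{C}\!\ell(1,1)^{N-1}$.
   Context: All algebras are real, associative and unital; $\otimes$ is the ordinary (ungraded) tensor product over $\mathbb{R}$ with multiplication $(A_1\otimes B_1)(A_2\otimes B_2)=(A_1A_2)\otimes(B_1B_2)$; $\simeq$ denotes isomorphism of real algebras. For nonnegative integers $p,q$ with $n=p+q\ge 1$, $\mathcal{C}\!\ell(p,q)$ is the real Clifford algebra of signature $(p,q)$: it has dimension $2^n$, identity $e$, and generators $e^1,\dots,e^n$ with $e^ae^b+e^be^a=0$ for $a\ne b$, $(e^a)^2=e$ for $a=1,\dots,p$, and $(e^a)^2=-e$ for $a=p+1,\dots,n$. Also $\mathcal{C}\!\ell(0,0)=\mathbb{R}$. For nonnegative integers $p,q$ with $n=p+q\ge 1$, $\mathcal{K}(p,q)$ is the commutative real algebra of dimension $2^n$ with identity $e$ and generators $e^1,\dots,e^n$ with $e^ae^b-e^be^a=0$ for $a\neq b$, $(e^a)^2=e$ for $a=1,\dots,p$, and $(e^a)^2=-e$ for $a=p+1,\dots,n$. Also $\mathcal{K}(0,0)=\mathbb{R}$. The extended Clifford algebra is $\mathcal{C}\!\ell(r,s|p,q):=\mathcal{K}(r,s)\otimes\mathcal{C}\!\ell(p,q)$, of real dimension $2^{r+s+p+q}$. $\mathcal{C}\!\ell(p,q)^M$ denotes the tensor product of $M$ copies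 of $\mathcal{C}\!\ell(p,q)$, with $\mathcal{C}\!\ell(p,q)^0:=\mathcal{C}\!\ell(0,0)\simeq\mathbb{R}$. *)

(* Defs.v *)
From HB Require Import structures.
From mathcomp Require Import all_boot all_order all_algebra all_field.
From mathcomp Require Import reals.

Set Implicit Arguments.
Unset Strict Implicit.
Unset Printing Implicit Defensive.
Import GRing.Theory.
Local Open Scope ring_scope.

(** * Algebras with basis the ordered monomials in generators that commute or
    anticommute pairwise and square to 1 or -1 *)

Definition symdiff n (A B : {set 'I_n}) : {set 'I_n} :=
  (A :\: B) :|: (B :\: A).

(* [beta a b] records whether moving the generator [a] rightwards past [b]
   (or, when [a = b], contracting the square of [a]) changes the sign.  The
   product of the monomials e_A and e_B is then [msign beta A B] times the
   monomial indexed by the symmetric difference of A and B. *)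
Definition msign (F : fieldType) n (beta : rel 'I_n) (A B : {set 'I_n}) : F :=
  \prod_(a in A) \prod_(b in B) (-1) ^+ beta a b.

(* The value at A of an element is its coordinate along e_A. *)
Definition monalg (F : fieldType) n (beta : rel 'I_n) : Type :=
  {ffun {set 'I_n} -> F^o}.

Section MonomialAlgebra.
Variables (F : fieldType) (n : nat) (beta : rel 'I_n).
Local Notation T := (monalg F beta).
Local Notation "A +^ B" := (symdiff A B) (at level 50).
Local Notation sg := (msign F beta).
Implicit Types (A B C : {set 'I_n}) (u v w : T).
Implicit Type a : 'I_n.

HB.instance Definition _ := Vector.on T.

Definition mono (A : {set 'I_n}) : T := [ffun B => (B == A)%:R].

Definition gen (a : 'I_n) : T := mono [set a].

Definition monalg_one : T := mono set0.

Definition monalg_mul (u v : T) : T :=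
  \sum_A \sum_B (u A * v B * sg A B) *: mono (A +^ B).

Lemma in_symdiff A B (x : 'I_n) :
  (x \in A +^ B) = (x \in A) (+) (x \in B).
Proof. by rewrite !inE; case: (x \in A); case: (x \in B). Qed.

Lemma symdiffA : associative (@symdiff n).
Proof. by move=> A B C; apply/setP=> x; rewrite !in_symdiff addbA. Qed.

Lemma symdiff0 A : A +^ set0 = A.
Proof. by apply/setP=> x; rewrite in_symdiff inE addbF. Qed.

Lemma symdiff0l A : set0 +^ A = A.
Proof. by apply/setP=> x; rewrite in_symdiff inE. Qed.

Lemma msignE A B :
  sg A B = \prod_a \prod_b (-1) ^+ [&& a \in A, b \in B & beta a b].
Proof.
rewrite /msign big_mkcond; apply: eq_bigr => a _; case: (a \in A) => /=.
  by rewrite big_mkcond; apply: eq_bigr => b _; case: (b \in B).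
by rewrite big1.
Qed.

Lemma msignDl A B C : sg (A +^ B) C = sg A C * sg B C.
Proof.
rewrite !msignE -big_split; apply: eq_bigr => a _; rewrite -big_split.
apply: eq_bigr => b _ /=; rewrite in_symdiff -signr_addb; congr (_ ^+ _); congr nat_of_bool.
by case: (a \in A); case: (a \in B); case: (b \in C); case: (beta a b).
Qed.

Lemma msignDr A B C : sg A (B +^ C) = sg A B * sg A C.
Proof.
rewrite !msignE -big_split; apply: eq_bigr => a _; rewrite -big_split.
apply: eq_bigr => b _ /=; rewrite in_symdiff -signr_addb; congr (_ ^+ _); congr nat_of_bool.
by case: (a \in A); case: (b \in C); case: (b \in B); case: (beta a b).
Qed.

Lemma msign0l A : sg set0 A = 1. Proof. by rewrite /msign big_set0. Qed.
Lemma msign0r A : sg A set0 = 1.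
Proof. by rewrite /msign big1 // => a _; rewrite big_set0. Qed.

Lemma mono_decomp (u : T) : u = \sum_A u A *: mono A.
Proof.
apply/ffunP=> B; rewrite sum_ffunE (bigD1 B) //= big1 => [|A neqAB].
  by rewrite !ffunE eqxx addr0 [_ *: _]mulr1.
by rewrite !ffunE eq_sym (negPf neqAB) scaler0.
Qed.

Lemma monalg_mulDl : left_distributive monalg_mul +%R.
Proof.
move=> u v w; rewrite -big_split; apply: eq_bigr => A _.
rewrite -big_split; apply: eq_bigr => B _ /=.
by rewrite ffunE -scalerDl !mulrDl.
Qed.

Lemma monalg_mulDr : right_distributive monalg_mul +%R.
Proof.
move=> u v w; rewrite -big_split; apply: eq_bigr => A _.
rewrite -big_split; apply: eq_bigr => B _ /=.
by rewrite ffunE -scalerDl mulrDr mulrDl.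
Qed.

Lemma monalg_scalerAl (k : F) (u v : T) :
  k *: monalg_mul u v = monalg_mul (k *: u) v.
Proof.
rewrite scaler_sumr; apply: eq_bigr => A _; rewrite scaler_sumr.
by apply: eq_bigr => B _; rewrite ffunE scalerA /GRing.scale /= !mulrA.
Qed.

Lemma monalg_scalerAr (k : F) (u v : T) :
  k *: monalg_mul u v = monalg_mul u (k *: v).
Proof.
rewrite scaler_sumr; apply: eq_bigr => A _; rewrite scaler_sumr.
apply: eq_bigr => B _; rewrite ffunE scalerA; congr (_ *: _).
by rewrite -[k *: v B]/(k * v B) (mulrCA (u A)) !mulrA.
Qed.

Lemma monalg_mul0l v : monalg_mul 0 v = 0.
Proof. by have := monalg_scalerAl 0 0 v; rewrite !scale0r => <-. Qed.

Lemma monalg_mul0r v : monalg_mul v 0 = 0.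
Proof. by have := monalg_scalerAr 0 v 0; rewrite !scale0r => <-. Qed.

Lemma monalg_mul_suml I (r : seq I) (f : I -> T) v :
  monalg_mul (\sum_(i <- r) f i) v = \sum_(i <- r) monalg_mul (f i) v.
Proof.
by apply: (big_morph (monalg_mul^~ v) (fun x y => monalg_mulDl x y v)
  (monalg_mul0l v)).
Qed.

Lemma monalg_mul_sumr I (r : seq I) (f : I -> T) v :
  monalg_mul v (\sum_(i <- r) f i) = \sum_(i <- r) monalg_mul v (f i).
Proof.
by apply: (big_morph (monalg_mul v) (monalg_mulDr v) (monalg_mul0r v)).
Qed.

Lemma monalg_mul_mono A B :
  monalg_mul (mono A) (mono B) = sg A B *: mono (A +^ B).
Proof.
rewrite /monalg_mul (bigD1 A) //= [X in _ + X]big1 => [|C neqCA]; last first.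
  by apply: big1 => D _; rewrite !ffunE (negPf neqCA) !mul0r scale0r.
rewrite addr0 (bigD1 B) //= big1 => [|D neqDB]; last first.
  by rewrite !ffunE (negPf neqDB) mulr0 mul0r scale0r.
by rewrite addr0 !ffunE !eqxx !mul1r.
Qed.

Lemma monalg_mulA : associative monalg_mul.
Proof.
have mul_suml u v : monalg_mul u v = \sum_A u A *: monalg_mul (mono A) v.
  rewrite {1}(mono_decomp u) monalg_mul_suml.
  by apply: eq_bigr => A _; rewrite monalg_scalerAl.
have mul_sumr u v : monalg_mul u v = \sum_A v A *: monalg_mul u (mono A).
  rewrite {1}(mono_decomp v) monalg_mul_sumr.
  by apply: eq_bigr => A _; rewrite monalg_scalerAr.
move=> u v w; rewrite [LHS]mul_suml (mul_suml u v) monalg_mul_suml.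
apply: eq_bigr => A _; rewrite -monalg_scalerAl; congr (_ *: _).
rewrite (mul_suml v w) (mul_sumr _ v) monalg_mul_suml monalg_mul_sumr.
apply: eq_bigr => B _; rewrite -monalg_scalerAl -monalg_scalerAr.
congr (_ *: _); rewrite (mul_sumr _ w) [RHS]mul_sumr monalg_mul_sumr.
apply: eq_bigr => C _; rewrite -monalg_scalerAr; congr (_ *: _).
rewrite !monalg_mul_mono -monalg_scalerAl -monalg_scalerAr !monalg_mul_mono.
rewrite !scalerA msignDl msignDr symdiffA; congr (_ *: _).
by rewrite mulrC mulrA.
Qed.

Lemma monalg_mul1l : left_id monalg_one monalg_mul.
Proof.
move=> u; rewrite (mono_decomp u) monalg_mul_sumr; apply: eq_bigr => A _.
by rewrite -monalg_scalerAr monalg_mul_mono msign0l symdiff0l scale1r.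
Qed.

Lemma monalg_mul1r : right_id monalg_one monalg_mul.
Proof.
move=> u; rewrite (mono_decomp u) monalg_mul_suml; apply: eq_bigr => A _.
by rewrite -monalg_scalerAl monalg_mul_mono msign0r symdiff0 scale1r.
Qed.

Lemma monalg_one_neq0 : monalg_one != 0.
Proof.
by apply/eqP=> /ffunP/(_ set0)/eqP; rewrite !ffunE eqxx oner_eq0.
Qed.

HB.instance Definition _ := GRing.Zmodule_isNzRing.Build T
  monalg_mulA monalg_mul1l monalg_mul1r monalg_mulDl monalg_mulDr
  monalg_one_neq0.
HB.instance Definition _ := GRing.Lmodule_isLalgebra.Build F T monalg_scalerAl.
HB.instance Definition _ := GRing.Lalgebra_isAlgebra.Build F T monalg_scalerAr.
HB.instance Definition _ := Algebra_isFalgebra.Build F T.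

Lemma monoM A B : mono A * mono B = sg A B *: mono (A +^ B).
Proof. exact: monalg_mul_mono. Qed.

Lemma dim_monalg : \dim {:T} = (2 ^ n)%N.
Proof.
have -> : \dim {:T} = #|{set 'I_n}| by rewrite dimvf; apply: muln1.
by rewrite -cardsT -powersetT card_powerset cardsT card_ord.
Qed.

Lemma gen_sqr a : gen a * gen a = (-1) ^+ beta a a.
Proof.
rewrite monoM /msign !big_set1 /symdiff setDv setU0.
by rewrite -[mono _]/(1 : T) scaler_sign; case: (beta a a).
Qed.

Lemma gen_swap a b :
  gen a * gen b = (-1) ^+ (beta a b (+) beta b a) * (gen b * gen a).
Proof.
rewrite !monoM /msign !big_set1 [_ +^ [set a]]/symdiff setUC -/(symdiff _ _).
by rewrite !scaler_sign mulr_sign; case: (beta a b); case: (beta b a); rewrite ?opprK.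
Qed.

Lemma mono_prod A : (forall a b : 'I_n, (a < b)%N -> ~~ beta a b) ->
  mono A = \prod_(a <- enum A) gen a.
Proof.
move=> beta_lt; have: sorted (relpre val ltn) (enum A).
  rewrite sorted_filter //; first by move=> ? ? ?; apply: ltn_trans.
  by rewrite -enumT -sorted_map val_enum_ord iota_ltn_sorted.
have -> : mono A = mono [set x in enum A] by rewrite set_enum.
elim: (enum A) => [_|a s IHs].
  by rewrite big_nil; congr (mono _); apply/setP=> x; rewrite !inE.
rewrite /= path_sortedE; last by move=> ? ? ?; apply: ltn_trans.
case/andP=> /allP lt_a_s /IHs{}IHs; rewrite big_cons -IHs monoM.
have -> : sg [set a] [set x in s] = 1.
  rewrite /msign big_set1 big1 // => b; rewrite inE => /lt_a_s /beta_lt.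
  by move/negPf->.
rewrite scale1r; congr (mono _); apply/setP=> x; rewrite in_symdiff !inE.
by case: eqP => // ->; case: (boolP (a \in s)) => // /lt_a_s; rewrite /= ltnn.
Qed.

End MonomialAlgebra.

(** * Tensor product of finite-dimensional algebras *)

(* The (i, j) entry of an element is its coordinate along the pure tensor of
   the i-th and j-th elements of the reference bases of A and B. *)
Definition tensor_alg (F : fieldType) (A B : falgType F) : Type :=
  'M[F]_(\dim {:A}, \dim {:B}).

Section TensorAlgebra.
Variables (F : fieldType) (A B : falgType F).
Local Notation T := (tensor_alg A B).
Local Notation bA := (vbasis {:A}).
Local Notation bB := (vbasis {:B}).
Implicit Types (a c : A) (b d : B) (u v w : T).

HB.instance Definition _ := Vector.on T.

Definition pure_tensor a b : T := \matrix_(i, j) (coord bA i a * coord bB j b).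
Local Notation "a *t b" := (pure_tensor a b) (at level 40).

Definition tensor_one : T := 1 *t 1.

Definition tensor_mul u v : T :=
  \sum_i \sum_j \sum_k \sum_l
    (u i j * v k l) *: ((bA`_i * bA`_k) *t (bB`_j * bB`_l)).

Lemma pure_tensorDl a c b : (a + c) *t b = a *t b + c *t b.
Proof. by apply/matrixP=> i j; rewrite !mxE linearD mulrDl. Qed.
Lemma pure_tensorDr a b d : a *t (b + d) = a *t b + a *t d.
Proof. by apply/matrixP=> i j; rewrite !mxE linearD mulrDr. Qed.
Lemma pure_tensorZl k a b : (k *: a) *t b = k *: (a *t b).
Proof. by apply/matrixP=> i j; rewrite !mxE linearZ mulrA. Qed.
Lemma pure_tensorZr k a b : a *t (k *: b) = k *: (a *t b).
Proof. by apply/matrixP=> i j; rewrite !mxE linearZ mulrCA. Qed.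
Lemma pure_tensor0l b : 0 *t b = 0.
Proof. by apply/matrixP=> i j; rewrite !mxE linear0 mul0r. Qed.
Lemma pure_tensor0r a : a *t 0 = 0.
Proof. by apply/matrixP=> i j; rewrite !mxE linear0 mulr0. Qed.

Lemma pure_tensor_suml I (r : seq I) (f : I -> A) b :
  (\sum_(i <- r) f i) *t b = \sum_(i <- r) f i *t b.
Proof.
exact: (big_morph (pure_tensor^~ b) (fun x y => pure_tensorDl x y b)
  (pure_tensor0l b)).
Qed.

Lemma pure_tensor_sumr I (r : seq I) a (f : I -> B) :
  a *t (\sum_(i <- r) f i) = \sum_(i <- r) a *t f i.
Proof. exact: (big_morph _ (pure_tensorDr a) (pure_tensor0r a)). Qed.

Lemma tensor_decomp u : u = \sum_i \sum_j u i j *: (bA`_i *t bB`_j).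
Proof.
rewrite {1}(matrix_sum_delta u); apply: eq_bigr => i _; apply: eq_bigr => j _.
congr (_ *: _); apply/matrixP=> k l; rewrite !mxE.
rewrite !(coord_free _ _ (basis_free (vbasisP _))) -natrM mulnb.
by rewrite (eq_sym i) (eq_sym j).
Qed.

Lemma tensor_mulDl : left_distributive tensor_mul +%R.
Proof.
move=> u v w; do 4![rewrite -big_split; apply: eq_bigr => ? _ /=].
by rewrite !mxE mulrDl scalerDl.
Qed.

Lemma tensor_mulDr : right_distributive tensor_mul +%R.
Proof.
move=> u v w; do 4![rewrite -big_split; apply: eq_bigr => ? _ /=].
by rewrite !mxE mulrDr scalerDl.
Qed.

Lemma tensor_scalerAl (k : F) u v : k *: tensor_mul u v = tensor_mul (k *: u) v.
Proof.
do 4![rewrite scaler_sumr; apply: eq_bigr => ? _].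
by rewrite scalerA !mxE mulrA.
Qed.

Lemma tensor_scalerAr (k : F) u v : k *: tensor_mul u v = tensor_mul u (k *: v).
Proof.
do 4![rewrite scaler_sumr; apply: eq_bigr => ? _].
by rewrite scalerA !mxE mulrCA.
Qed.

Lemma tensor_mul0l v : tensor_mul 0 v = 0.
Proof. by have := tensor_scalerAl 0 0 v; rewrite !scale0r => <-. Qed.

Lemma tensor_mul0r v : tensor_mul v 0 = 0.
Proof. by have := tensor_scalerAr 0 v 0; rewrite !scale0r => <-. Qed.

Lemma tensor_mul_suml I (r : seq I) (f : I -> T) v :
  tensor_mul (\sum_(i <- r) f i) v = \sum_(i <- r) tensor_mul (f i) v.
Proof.
exact: (big_morph (tensor_mul^~ v) (fun x y => tensor_mulDl x y v)
  (tensor_mul0l v)).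
Qed.

Lemma tensor_mul_sumr I (r : seq I) (f : I -> T) v :
  tensor_mul v (\sum_(i <- r) f i) = \sum_(i <- r) tensor_mul v (f i).
Proof. exact: (big_morph _ (tensor_mulDr v) (tensor_mul0r v)). Qed.

Lemma tensor_mul_pure a b c d :
  tensor_mul (a *t b) (c *t d) = (a * c) *t (b * d).
Proof.
rewrite {2}(coord_vbasis (memvf a)) mulr_suml pure_tensor_suml.
apply: eq_bigr => i _; rewrite {2}(coord_vbasis (memvf b)) mulr_suml.
rewrite pure_tensor_sumr; apply: eq_bigr => j _.
rewrite {2}(coord_vbasis (memvf c)) mulr_sumr pure_tensor_suml.
apply: eq_bigr => k _; rewrite {2}(coord_vbasis (memvf d)) mulr_sumr.
rewrite pure_tensor_sumr; apply: eq_bigr => l _.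
rewrite -!scalerAl -!scalerAr !(pure_tensorZl, pure_tensorZr) !scalerA !mxE.
by congr (_ *: _); rewrite -!mulrA; congr (_ * _); rewrite mulrCA.
Qed.

Lemma tensor_ind (P : T -> Prop) :
  (forall u v, P u -> P v -> P (u + v)) -> (forall a b, P (a *t b)) ->
  forall u, P u.
Proof.
move=> PD Pt u; have P0 : P 0 by rewrite -(pure_tensor0l 0).
rewrite (tensor_decomp u); do 2![elim/big_ind: _ => // ? _].
by rewrite -pure_tensorZl.
Qed.

Lemma tensor_mulA : associative tensor_mul.
Proof.
elim/tensor_ind=> [u1 u2 IH1 IH2|a1 b1] v w; first by rewrite !tensor_mulDl IH1 IH2.
elim/tensor_ind: v => [v1 v2 IH1 IH2|a2 b2].
  by rewrite !(tensor_mulDl, tensor_mulDr) IH1 IH2.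
elim/tensor_ind: w => [w1 w2 IH1 IH2|a3 b3]; first by rewrite !tensor_mulDr IH1 IH2.
by rewrite !tensor_mul_pure !mulrA.
Qed.

Lemma tensor_mul1l : left_id tensor_one tensor_mul.
Proof.
elim/tensor_ind=> [u v IH1 IH2|a b]; first by rewrite tensor_mulDr IH1 IH2.
by rewrite tensor_mul_pure !mul1r.
Qed.

Lemma tensor_mul1r : right_id tensor_one tensor_mul.
Proof.
elim/tensor_ind=> [u v IH1 IH2|a b]; first by rewrite tensor_mulDl IH1 IH2.
by rewrite tensor_mul_pure !mulr1.
Qed.

Lemma tensor_one_neq0 : tensor_one != 0.
Proof.
have coordN0 (C : falgType F) : exists i, coord (vbasis {:C}) i 1 != 0.
  apply/existsP; apply: contraT; rewrite negb_exists => /forallP c0.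
  have/eqP[] := oner_neq0 C; rewrite (coord_vbasis (memvf 1)) big1 // => i _.
  by move/(_ i): c0; rewrite negbK => /eqP->; rewrite scale0r.
have [i nz_i] := coordN0 A; have [j nz_j] := coordN0 B.
apply/eqP=> /matrixP/(_ i j)/eqP; rewrite !mxE mulf_eq0.
by rewrite (negPf nz_i) (negPf nz_j).
Qed.

HB.instance Definition _ := GRing.Zmodule_isNzRing.Build T
  tensor_mulA tensor_mul1l tensor_mul1r tensor_mulDl tensor_mulDr
  tensor_one_neq0.
HB.instance Definition _ := GRing.Lmodule_isLalgebra.Build F T tensor_scalerAl.
HB.instance Definition _ := GRing.Lalgebra_isAlgebra.Build F T tensor_scalerAr.
HB.instance Definition _ := Algebra_isFalgebra.Build F T.

Lemma pure_tensorM a b c d : (a *t b) * (c *t d) = (a * c) *t (b * d).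
Proof. exact: tensor_mul_pure. Qed.

Lemma dim_tensor : \dim {:T} = (\dim {:A} * \dim {:B})%N.
Proof. by rewrite dimvf. Qed.

End TensorAlgebra.

(** * Clifford algebras *)

Section Clifford.
Variables (F : fieldType) (p q : nat).
Implicit Types a b : 'I_(p + q).

(* Generators are indexed from 0: those with index below p square to 1, the
   remaining q square to -1. *)
Definition cliff_sign : rel 'I_(p + q) :=
  fun a b => (b < a)%N || ((a == b) && (p <= a)%N).

Definition comm_sign : rel 'I_(p + q) :=
  fun a b => (a == b) && (p <= a)%N.

Definition clifford : falgType F := monalg F cliff_sign.

Definition comm_clifford : falgType F := monalg F comm_sign.

Definition cliff_gen a : clifford := gen F cliff_sign a.

Definition comm_gen a : comm_clifford := gen F comm_sign a.

Lemma cliff_gen_sqr a : cliff_gen a ^+ 2 = if (a < p)%N then 1 else -1.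
Proof.
rewrite expr2 [LHS]gen_sqr /cliff_sign ltnn eqxx /= leqNgt.
by case: (a < p)%N.
Qed.

Lemma cliff_gen_anticomm a b :
  a != b -> cliff_gen a * cliff_gen b + cliff_gen b * cliff_gen a = 0.
Proof.
move=> neq_ab; rewrite [cliff_gen a * _]gen_swap /cliff_sign [b == a]eq_sym.
rewrite (negPf neq_ab) !orbF; move: neq_ab; rewrite -val_eqE /=.
by case: ltngtP => //= _ _; rewrite mulN1r addNr.
Qed.

Lemma cliff_mono_prod (A : {set 'I_(p + q)}) :
  mono F cliff_sign A = \prod_(a <- enum A) cliff_gen a.
Proof.
apply: mono_prod => a b lt_ab; rewrite /cliff_sign ltnNge (ltnW lt_ab) /=.
by rewrite -val_eqE (ltn_eqF lt_ab).
Qed.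

Lemma dim_clifford : \dim {:clifford} = (2 ^ (p + q))%N.
Proof. exact: dim_monalg. Qed.

Lemma comm_gen_sqr a : comm_gen a ^+ 2 = if (a < p)%N then 1 else -1.
Proof.
rewrite expr2 [LHS]gen_sqr /comm_sign eqxx /= leqNgt.
by case: (a < p)%N.
Qed.

Lemma comm_gen_comm a b : comm_gen a * comm_gen b = comm_gen b * comm_gen a.
Proof.
have [-> //|neq_ab] := eqVneq a b.
rewrite [LHS]gen_swap /comm_sign [b == a]eq_sym (negPf neq_ab) /=.
by rewrite mul1r.
Qed.

Lemma comm_mono_prod (A : {set 'I_(p + q)}) :
  mono F comm_sign A = \prod_(a <- enum A) comm_gen a.
Proof.
by apply: mono_prod => a b lt_ab; rewrite /comm_sign -val_eqE (ltn_eqF lt_ab).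
Qed.

Lemma dim_comm_clifford : \dim {:comm_clifford} = (2 ^ (p + q))%N.
Proof. exact: dim_monalg. Qed.

End Clifford.

Definition tensor (F : fieldType) (A B : falgType F) : falgType F :=
  tensor_alg A B.

Definition ext_clifford (F : fieldType) (r s p q : nat) : falgType F :=
  tensor (comm_clifford F r s) (clifford F p q).

Fixpoint clifford_pow (F : fieldType) (p q M : nat) : falgType F :=
  match M with
  | 0 => clifford F 0 0
  | 1 => clifford F p q
  | M'.+1 => tensor (clifford F p q) (clifford_pow F p q M')
  end.

Definition alg_iso (F : fieldType) (A B : falgType F) : Prop :=
  exists f : {lrmorphism A -> B}, bijective f.

(* Main.v *)
(* A family of generators that pairwise commute (or pairwise anticommute),
   square to 1 or -1 and generate an algebra of dimension 2^n determines that
   algebra up to isomorphism, by the number of generators of each sign.  Choosing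
   such families inside tensor products gives, with w = xy the product of the two
   generators x, y of a Clifford algebra A of rank 2, the splitting
   A (x) Cl(p,q) = Cl of the generators x (x) 1, y (x) 1 and w (x) e^a, where
   w^2 = 1 for Cl(1,1) and w^2 = -1 (which swaps p and q) for Cl(2,0) and Cl(0,2).
   Moreover Cl(2,0) = Cl(1,1), and reading Cl(2,2) and Cl(1,2) in two ways gives
   Cl(0,2) (x) Cl(0,2) = Cl(1,1) (x) Cl(1,1) and
   Cl(0,1) (x) Cl(0,2) = Cl(0,1) (x) Cl(1,1).
   Induction on p + q brings Cl(p,q) to a normal form depending on p - q mod 8;
   K(r,s) splits into copies of Cl(1,0) and Cl(0,1), and one factor Cl(0,1)
   turns every Cl(1,0) into Cl(0,1) and every Cl(0,2) into Cl(1,1). *)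
From HB Require Import structures.
From Stdlib Require Import Setoid Morphisms.
Require Import Defs.
From mathcomp Require Import all_boot all_order all_algebra all_field.
From mathcomp Require Import reals zify.
Set Implicit Arguments.
Unset Strict Implicit.
Unset Printing Implicit Defensive.
Import GRing.Theory.
Local Open Scope ring_scope.

Local Notation "a *t b" := (pure_tensor a b) (at level 40).

(** * Algebra morphisms as bare functions, and criteria for isomorphism *)

Section AlgebraMorphisms.
Variable F : fieldType.
Implicit Types A B C D : falgType F.

Definition alg_mor A B (f : A -> B) : Prop :=
  [/\ linear f, f 1 = 1 & {morph f : x y / x * y}].

(** Generation is encoded as an induction principle, so that it can be eliminated directly into any
    property stable under the algebra operations. *)
Definition generates A (gs : seq A) : Prop := forall P : A -> Prop,
  P 1 -> (forall k x y, P x -> P y -> P (k *: x + y)) ->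
  (forall x y, P x -> P y -> P (x * y)) ->
  {in gs, forall x, P x} -> forall x, P x.

Lemma alg_mor_id A : alg_mor (@id A).
Proof. by []. Qed.

Lemma alg_mor_comp A B C (g : B -> C) (f : A -> B) :
  alg_mor g -> alg_mor f -> alg_mor (g \o f).
Proof.
move=> [gL g1 gM] [fL f1 fM]; split=> [k x y||x y] /=.
- by rewrite fL gL.
- by rewrite f1 g1.
- by rewrite fM gM.
Qed.

Lemma alg_morD A B (f : A -> B) : alg_mor f -> {morph f : x y / x + y}.
Proof. by case=> fL _ _ x y; rewrite -[x]scale1r fL !scale1r. Qed.

Lemma alg_mor0 A B (f : A -> B) : alg_mor f -> f 0 = 0.
Proof. by move/alg_morD=> fD; apply: (addrI (f 0)); rewrite -fD !addr0. Qed.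

Lemma alg_morZ A B (f : A -> B) k : alg_mor f -> {morph f : x / k *: x}.
Proof.
by move=> fm x; case: (fm) => fL _ _; rewrite -[k *: x]addr0 fL alg_mor0 // !addr0.
Qed.

Lemma alg_mor_iso A B (f : A -> B) : alg_mor f -> bijective f -> alg_iso A B.
Proof.
case=> fL f1 fM bij_f.
pose f_lin := GRing.isLinear.Build F A B *:%R f fL.
pose f_mul := GRing.isMonoidMorphism.Build A B f (conj f1 fM).
pose f' : {lrmorphism A -> B} := HB.pack f f_lin f_mul.
by exists f'.
Qed.

Lemma alg_isoP A B : alg_iso A B <-> exists2 f : A -> B, alg_mor f & bijective f.
Proof.
split=> [[f bij_f]|[f]]; last exact: alg_mor_iso.
by exists f => //; split; [exact: linearP | exact: rmorph1 | exact: rmorphM].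
Qed.

(** By rank-nullity, surjectivity and equal dimensions force a zero kernel; injectivity is never
    checked by hand below. *)
Lemma surj_alg_iso A B (f : A -> B) : alg_mor f -> \dim {:A} = \dim {:B} ->
  (forall y, exists x, f x = y) -> alg_iso A B.
Proof.
move=> fm eq_dim surj; apply: (alg_mor_iso fm); case: (fm) => fL f1 fM.
pose f_lin := GRing.isLinear.Build F A B *:%R f fL.
pose f' : {linear A -> B} := HB.pack f f_lin.
pose h := linfun f'.
have hE x : h x = f x by rewrite lfunE.
have limg_h : limg h = fullv.
  apply/vspaceP=> y; rewrite memvf.
  by have [x <-] := surj y; rewrite -hE memv_img ?memvf.
have ker0 : lker h == 0%VS.
  have := limg_ker_dim h fullv; rewrite capfv limg_h eq_dim -[RHS]add0n.
  by move/addIn/eqP; rewrite dimv_eq0.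
exists (h^-1%VF) => x; rewrite -hE; first exact: lker0_lfunK.
by apply: limg_lfunVK; rewrite limg_h memvf.
Qed.

(** The image of [f] is a subalgebra, hence everything once it contains generators. *)
Lemma generates_alg_iso A B (f : A -> B) (gs : seq B) :
  alg_mor f -> \dim {:A} = \dim {:B} -> generates gs ->
  {in gs, forall y, exists x, f x = y} -> alg_iso A B.
Proof.
move=> fm eq_dim gen_gs gs_im; apply: (surj_alg_iso fm eq_dim).
case: (fm) => fL f1 fM; apply: gen_gs => //; first by exists 1.
  by move=> k _ _ [x <-] [y <-]; exists (k *: x + y); rewrite fL.
by move=> _ _ [x <-] [y <-]; exists (x * y); rewrite fM.
Qed.

Lemma alg_iso_refl A : alg_iso A A.
Proof. by apply: (alg_mor_iso (alg_mor_id A)); exists id. Qed.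

Lemma alg_iso_trans B A C : alg_iso A B -> alg_iso B C -> alg_iso A C.
Proof.
move=> /alg_isoP[f fm f_bij] /alg_isoP[g gm g_bij].
exact: alg_mor_iso (alg_mor_comp gm fm) (bij_comp g_bij f_bij).
Qed.

Lemma alg_iso_sym A B : alg_iso A B -> alg_iso B A.
Proof.
case=> f [g fK gK]; apply: (@alg_mor_iso _ _ g); last by exists f.
by have [g1 gM] := can2_monoid_morphism fK gK; split=> //; exact: (can2_linear fK gK).
Qed.

Lemma alg_iso_dim A B : alg_iso A B -> \dim {:A} = \dim {:B}.
Proof.
move=> [f [g fK gK]]; pose h := linfun f.
have hE x : h x = f x by rewrite lfunE.
have ker0 : lker h == 0%VS.
  by apply/lker0P => x y; rewrite !hE; apply: (can_inj fK).
rewrite -(limg_dim_eq (f := h)) ?(eqP ker0) ?capv0 //; congr (\dim _).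
apply/vspaceP=> y; rewrite memvf.
by rewrite -(gK y) -hE memv_img ?memvf.
Qed.

End AlgebraMorphisms.

(** * Universal property of the tensor product; commutativity, congruence, associativity *)

Section TensorCalculus.
Variable F : fieldType.
Implicit Types A B C D : falgType F.

Lemma dim_tensorE A B : \dim {:tensor A B} = (\dim {:A} * \dim {:B})%N.
Proof. exact: dim_tensor. Qed.

Lemma tensorM A B (a c : A) (b d : B) :
  (a *t b) * (c *t d) = (a * c) *t (b * d) :> tensor A B.
Proof. exact: pure_tensorM. Qed.

Lemma alg_mor_tensorl A B : alg_mor (fun a : A => (a *t 1 : tensor A B)).
Proof.
split=> [k x y||x y] //=; first by rewrite pure_tensorDl pure_tensorZl.
by rewrite tensorM mulr1.
Qed.

Lemma alg_mor_tensorr A B : alg_mor (fun b : B => (1 *t b : tensor A B)).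
Proof.
split=> [k x y||x y] //=; first by rewrite pure_tensorDr pure_tensorZr.
by rewrite tensorM mulr1.
Qed.

(** Universal property. The map is defined through coordinates in the reference bases;
    multiplicativity is checked on pure tensors, where the commuting images allow [g b] and [f c] to
    be exchanged. *)
Lemma tensor_lift A B C (f : A -> C) (g : B -> C) :
  alg_mor f -> alg_mor g -> (forall a b, f a * g b = g b * f a) ->
  exists2 h : tensor A B -> C, alg_mor h & forall a b, h (a *t b) = f a * g b.
Proof.
move=> fm gm fg.
pose h (u : tensor A B) : C :=
  \sum_i \sum_j (u : tensor_alg A B) i j *: (f (vbasis {:A})`_i * g (vbasis {:B})`_j).
have hL : linear h.
  move=> k u v; rewrite /h scaler_sumr -big_split; apply: eq_bigr => i _ /=.
  rewrite scaler_sumr -big_split; apply: eq_bigr => j _ /=.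
  by rewrite !mxE scalerDl scalerA.
have hD u v : h (u + v) = h u + h v by rewrite -[u]scale1r hL !scale1r.
have f_sum (I : finType) (G : I -> A) : f (\sum_i G i) = \sum_i f (G i).
  exact: (big_morph f (alg_morD fm) (alg_mor0 fm)).
have g_sum (I : finType) (G : I -> B) : g (\sum_i G i) = \sum_i g (G i).
  exact: (big_morph g (alg_morD gm) (alg_mor0 gm)).
have hE a b : h (a *t b) = f a * g b.
  rewrite {2}(coord_vbasis (memvf a)) {2}(coord_vbasis (memvf b)) f_sum g_sum.
  rewrite mulr_suml; apply: eq_bigr => i _; rewrite mulr_sumr.
  apply: eq_bigr => j _; rewrite mxE (alg_morZ _ fm) (alg_morZ _ gm).
  by rewrite -scalerAl -scalerAr scalerA.
exists h => //; case: (fm) (gm) => [_ f1 fM] [_ g1 gM].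
split=> //; first by rewrite [1]/(1 *t 1) hE f1 g1 mulr1.
elim/tensor_ind=> [u1 u2 IH1 IH2 v|a b]; first by rewrite mulrDl !hD IH1 IH2 mulrDl.
elim/tensor_ind=> [v1 v2 IH1 IH2|c d]; first by rewrite mulrDr !hD IH1 IH2 mulrDr.
rewrite tensorM !hE fM gM -!mulrA; congr (_ * _).
by rewrite !mulrA fg.
Qed.

Lemma tensor_comm A B : alg_iso (tensor A B) (tensor B A).
Proof.
have [|h hm hE] := tensor_lift (alg_mor_tensorr B A) (alg_mor_tensorl B A).
  by move=> a b; rewrite !tensorM !mul1r !mulr1.
apply: (surj_alg_iso hm); first by rewrite !dim_tensorE mulnC.
elim/tensor_ind=> [_ _ [u <-] [v <-]|b a]; first by exists (u + v); rewrite alg_morD.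
by exists (a *t b); rewrite hE tensorM mulr1 mul1r.
Qed.

Lemma tensor_congr A A' B B' :
  alg_iso A A' -> alg_iso B B' -> alg_iso (tensor A B) (tensor A' B').
Proof.
move=> isoA isoB; have [eqA eqB] := (alg_iso_dim isoA, alg_iso_dim isoB).
have /alg_isoP[f fm [f' _ f'K]] := isoA; have /alg_isoP[g gm [g' _ g'K]] := isoB.
have [|h hm hE] := tensor_lift (alg_mor_comp (alg_mor_tensorl A' B') fm)
                     (alg_mor_comp (alg_mor_tensorr A' B') gm).
  by move=> a b; rewrite !tensorM !mul1r !mulr1.
apply: (surj_alg_iso hm); first by rewrite !dim_tensorE eqA eqB.
elim/tensor_ind=> [_ _ [u <-] [v <-]|b a]; first by exists (u + v); rewrite alg_morD.
by exists (f' b *t g' a); rewrite hE tensorM /= mulr1 mul1r f'K g'K.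
Qed.

Lemma tensor_assoc A B C :
  alg_iso (tensor A (tensor B C)) (tensor (tensor A B) C).
Proof.
pose iAB := alg_mor_tensorl (tensor A B) C.
(* Two nested lifts: first on B ⊗ C, then on A together with the map just obtained. *)
have [|g gm gE] := tensor_lift (alg_mor_comp iAB (alg_mor_tensorr A B))
                     (alg_mor_tensorr (tensor A B) C).
  by move=> b c; rewrite !tensorM !mul1r !mulr1.
have [|h hm hE] := tensor_lift (alg_mor_comp iAB (alg_mor_tensorl A B)) gm.
  move=> a; elim/tensor_ind=> [u v IHu IHv|b c].
    by rewrite alg_morD // mulrDr mulrDl IHu IHv.
  by rewrite gE /= !(tensorM, mul1r, mulr1).
apply: (surj_alg_iso hm); first by rewrite !dim_tensorE mulnA.
elim/tensor_ind=> [_ _ [u <-] [v <-]|w c]; first by exists (u + v); rewrite alg_morD.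
elim/tensor_ind: w => [u v [x xE] [y yE]|a b].
  by exists (x + y); rewrite alg_morD // xE yE pure_tensorDl.
by exists (a *t (b *t c)); rewrite hE gE /= !(tensorM, mul1r, mulr1).
Qed.

End TensorCalculus.

(** * Presentation of a monomial algebra by generators and relations *)

Section MonomialPresentation.
Variables (F : fieldType) (n : nat) (beta : rel 'I_n) (A : falgType F).
Variable g : 'I_n -> A.
(** A sign can arise only when a generator passes a smaller one or meets itself, so monomials
    correspond to products in increasing order. *)
Hypothesis beta_lt : forall a b : 'I_n, (a < b)%N -> beta a b = false.
Hypothesis g_sqr : forall a, g a * g a = (-1) ^+ beta a a.
Hypothesis g_swap :
  forall a b : 'I_n, (a < b)%N -> g b * g a = (-1) ^+ beta b a * (g a * g b).

Implicit Types (a b : 'I_n) (S T : {set 'I_n}).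

Local Notation sg := (msign F beta).
Let gprod (S : {set 'I_n}) : A := \prod_(a <- enum S) g a.
Let ltI : rel 'I_n := relpre val ltn.

Lemma ltI_trans : transitive ltI.
Proof. by move=> x y z; apply: ltn_trans. Qed.

Lemma sorted_enum S : sorted ltI (enum S).
Proof.
rewrite sorted_filter //; first exact: ltI_trans.
by rewrite -enumT -sorted_map val_enum_ord iota_ltn_sorted.
Qed.

Lemma gprod0 : gprod set0 = 1.
Proof. by rewrite /gprod enum_set0 big_nil. Qed.

Lemma gprod_min b S :
  (forall x, x \in S -> (b < x)%N) -> gprod (b |: S) = g b * gprod S.
Proof.
move=> bS; suff -> : gprod (b |: S) = \prod_(a <- b :: enum S) g a.
  by rewrite big_cons.
congr bigop; apply: (irr_sorted_eq ltI_trans (fun x => ltnn _) (sorted_enum _)).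
  rewrite /= (path_sortedE ltI_trans) sorted_enum andbT.
  by apply/allP=> x; rewrite mem_enum => /bS.
by move=> x; rewrite !(mem_enum, inE).
Qed.

Lemma msign_min b S :
  (forall x, x \in S -> (b < x)%N) -> sg [set b] S = 1.
Proof.
by move=> bS; rewrite /msign big_set1 big1 // => x /bS/beta_lt->.
Qed.

(** Induction on the increasing list of S, comparing [a] with the least element [b]: if a < b the
    product is already ordered, if b < a the generator is moved past [b], and if they agree the
    square is contracted. *)
Lemma gen_gprod a S : g a * gprod S = sg [set a] S *: gprod (symdiff [set a] S).
Proof.
have -> : S = [set x in enum S] by rewrite set_enum.
elim: (enum S) (sorted_enum S) => [_|b s IHs].
  have -> : [set x in [::]] = set0 :> {set 'I_n} by apply/setP=> x; rewrite !inE.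
  rewrite msign0r scale1r symdiff0 gprod0 -gprod0 -gprod_min ?setU0 // => x.
  by rewrite inE.
rewrite /= (path_sortedE ltI_trans) => /andP[/allP b_lt /IHs{}IHs].
rewrite set_cons; set S' := [set x in s] in IHs *.
have bS x : x \in S' -> (b < x)%N by rewrite inE => /b_lt.
have bNS : b \notin S' by apply/negP=> /bS; rewrite ltnn.
rewrite gprod_min //.
have sgE : sg [set a] (b |: S') = (-1) ^+ beta a b * sg [set a] S'.
  by rewrite /msign !big_set1 big_setU1.
case: (ltngtP a b) => [lt_ab|lt_ba|/val_inj eq_ab].
- have aS x : x \in b |: S' -> (a < x)%N.
    by rewrite !inE => /orP[/eqP-> //|/b_lt]; apply: ltn_trans.
  have -> : symdiff [set a] (b |: S') = a |: (b |: S').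
    apply/setP=> x; rewrite in_symdiff in_set1 [in RHS]in_setU1.
    by case: eqP => // ->; case: (boolP (a \in b |: S')) => // /aS; rewrite ltnn.
  by rewrite msign_min // scale1r !gprod_min.
- have -> : symdiff [set a] (b |: S') = b |: symdiff [set a] S'.
    apply/setP=> x; rewrite !(in_symdiff, in_setU1, in_set1).
    case: (eqVneq x b) => //= ->.
    by rewrite -val_eqE (ltn_eqF lt_ba).
  rewrite gprod_min => [|x].
    by rewrite mulrA g_swap // -!mulrA IHs -scalerAr sgE -scalerA scaler_sign mulr_sign.
  by rewrite in_symdiff in_set1; case: eqP => [-> //|_ /bS].
- rewrite sgE -eq_ab mulrA g_sqr.
  have -> : symdiff [set a] (a |: S') = S'.
    rewrite eq_ab; apply/setP=> x; rewrite !(in_symdiff, in_setU1, in_set1).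
    by case: eqP => // ->; rewrite (negPf bNS).
  rewrite msign_min ?mulr1 => [|x]; last by rewrite eq_ab => /bS.
  by rewrite mulr_sign scaler_sign.
Qed.

(** The least generator of the left factor is peeled off and reinserted by [gen_gprod]; the signs
    combine because [msign] is multiplicative in each argument. *)
Lemma gprodM S T : gprod S * gprod T = sg S T *: gprod (symdiff S T).
Proof.
have -> : S = [set x in enum S] by rewrite set_enum.
elim: (enum S) (sorted_enum S) => [_|b s IHs].
  have -> : [set x in [::]] = set0 :> {set 'I_n} by apply/setP=> x; rewrite !inE.
  by rewrite gprod0 mul1r msign0l scale1r symdiff0l.
rewrite /= (path_sortedE ltI_trans) => /andP[/allP b_lt /IHs{}IHs].
rewrite set_cons; set S' := [set x in s] in IHs *.
have bS x : x \in S' -> (b < x)%N by rewrite inE => /b_lt.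
have -> : b |: S' = symdiff [set b] S'.
  apply/setP=> x; rewrite !(in_symdiff, in_setU1, in_set1).
  by case: eqP => // ->; case: (boolP (b \in S')) => // /bS; rewrite ltnn.
rewrite -[gprod (symdiff _ _)]scale1r -(msign_min bS) -gen_gprod -mulrA IHs.
rewrite -scalerAr gen_gprod scalerA symdiffA; congr (_ *: _).
by rewrite !(msignDl, msignDr) (msign_min bS) mul1r mulrC.
Qed.

(** Sending each monomial to the ordered product in A is a morphism by [gprodM] and reaches all
    generators. The dimension hypothesis replaces a proof that the ordered products are
    independent. *)
Lemma monalg_presentation : \dim {:A} = (2 ^ n)%N ->
  generates (codom g) -> alg_iso (monalg F beta : falgType F) A.
Proof.
move=> dimA gen_g.
pose B : falgType F := monalg F beta.
pose f (u : B) : A := \sum_S (u : monalg F beta) S *: gprod S.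
have fL : linear f.
  move=> k u v; rewrite /f scaler_sumr -big_split; apply: eq_bigr => S _ /=.
  by rewrite !ffunE scalerDl scalerA.
have fD u v : f (u + v) = f u + f v by rewrite -[u]scale1r fL !scale1r.
have f0 : f 0 = 0 by apply: (addrI (f 0)); rewrite -fD !addr0.
have fZ k u : f (k *: u) = k *: f u by rewrite -[k *: u]addr0 fL f0 addr0.
have f_sum (I : finType) (G : I -> B) : f (\sum_i G i) = \sum_i f (G i).
  exact: (big_morph f fD f0).
have fmono S : f (mono F beta S) = gprod S.
  rewrite /f (bigD1 S) //= big1 => [|T neqTS]; rewrite ffunE.
    by rewrite eqxx addr0 scale1r.
  by rewrite (negPf neqTS) scale0r.
have fm : alg_mor f.
  split=> [//||u v]; first by rewrite [1]/(mono F beta set0 : B) fmono gprod0.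
  rewrite [f u]/f [f v]/f f_sum mulr_suml; apply: eq_bigr => S _.
  rewrite mulr_sumr f_sum; apply: eq_bigr => T _.
  by rewrite fZ fmono -[RHS]scalerAl -scalerAr gprodM !scalerA.
apply: (generates_alg_iso fm _ gen_g); first by rewrite dimA dim_monalg.
move=> _ /codomP[a ->]; exists (gen F beta a); rewrite fmono /gprod.
by rewrite enum_set1 big_seq1.
Qed.

End MonomialPresentation.

(** * Lists of signed generators, treating K(p,q) and Cl(p,q) uniformly *)

Section MonomialSystems.
Variable F : fieldType.
Implicit Types (A B : falgType F) (c : bool) (p q : nat).

(** The list may mix signs in any order, so that systems inside tensor products can be written down
    without sorting. *)
Definition mono_system c A (l : seq (bool * A)) : Prop :=
  [/\ all (fun x : bool * A => x.2 * x.2 == (-1) ^+ x.1) l,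
      pairwise (fun x y : bool * A => x.2 * y.2 == (-1) ^+ c * (y.2 * x.2)) l
    & generates (map snd l)].

(* [c] tells whether distinct generators anticommute. *)
Definition sign_clifford c p q : falgType F :=
  if c then clifford F p q else comm_clifford F p q.

(** Common form of [cliff_sign] (c true) and [comm_sign] (c false). *)
Definition sign_rel c p q : rel 'I_(p + q) :=
  fun a b => (c && (b < a)%N) || ((a == b) && (p <= a)%N).
Arguments sign_rel : clear implicits.

Lemma sign_cliffordE c p q : sign_clifford c p q = monalg F (sign_rel c p q).
Proof. by case: c. Qed.

Lemma generates_eq_mem A (gs hs : seq A) : gs =i hs -> generates gs -> generates hs.
Proof.
move=> eq_gh gen_gs P P1 PL PM Phs; apply: gen_gs => // x.
by rewrite eq_gh => /Phs.
Qed.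

Lemma pairwise_cat_filter (T : Type) (r : rel T) (a : pred T) l :
  symmetric r -> pairwise r l ->
  pairwise r (filter (predC a) l ++ filter a l).
Proof.
move=> r_sym; elim: l => //= x l IHl /andP[rxl /IHl].
have rx b : all (r x) (filter b l).
  by rewrite all_filter; apply: sub_all rxl => y /= ->; rewrite implybT.
rewrite !pairwise_cat => /and3P[r_all r1 r2]; case: (a x) => /=.
  rewrite r1 r2 (rx a) allrel_consr r_all /= !andbT.
  by rewrite (eq_all (r_sym^~ x)) rx.
by rewrite allrel_consl (rx a) r_all (rx (predC a)) r1 r2.
Qed.

(** The generators of square 1 are moved to the front, as the indexing of [sign_rel] demands; then
    [monalg_presentation] applies. *)
Lemma mono_system_iso c A (l : seq (bool * A)) p q :
  mono_system c l -> count negb (map fst l) = p -> count id (map fst l) = q ->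
  \dim {:A} = (2 ^ (p + q))%N -> alg_iso (sign_clifford c p q) A.
Proof.
case=> l_sqr l_pair l_gen; rewrite !count_map -!size_filter => def_p def_q dimA.
pose pos := filter (predC fst) l; pose neg := filter fst l.
pose x0 : bool * A := (false, 0); pose l' := pos ++ neg.
have def_p' : size pos = p by rewrite -def_p.
have sz_l' : size l' = (p + q)%N by rewrite size_cat def_p' -def_q.
have perm_l : perm_eq l' l by rewrite perm_catC /l'; apply/permPl/perm_filterC.
pose g (a : 'I_(p + q)) := (nth x0 l' a).2.
have g_in (a : 'I_(p + q)) : nth x0 l' a \in l' by rewrite mem_nth ?sz_l'.
have sgn (a : 'I_(p + q)) : (nth x0 l' a).1 = (p <= a)%N.
  rewrite nth_cat def_p'; case: ltnP => [lt_ap|le_pa].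
    have: nth x0 pos a \in pos by rewrite mem_nth ?def_p'.
    by rewrite mem_filter => /andP[/negbTE].
  have: nth x0 neg (a - p) \in neg.
    by rewrite mem_nth // def_q ltn_subLR.
  by rewrite mem_filter => /andP[].
have l'_pair : pairwise (fun x y : bool * A => x.2 * y.2 == (-1) ^+ c * (y.2 * x.2)) l'.
  (* Reordering is harmless: commuting and anticommuting are symmetric relations. *)
  apply: pairwise_cat_filter l_pair => x y; rewrite !mulr_sign.
  by case: (c); rewrite [in LHS]eq_sym // eqr_oppLR.
rewrite sign_cliffordE; apply: (monalg_presentation (g := g)) => //.
- move=> a b lt_ab; rewrite /sign_rel -val_eqE (ltn_eqF lt_ab) orbF.
  by rewrite ltnNge ltnW ?andbF.
- move=> a; rewrite /sign_rel ltnn andbF eqxx /= -sgn.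
  by have := g_in a; rewrite (perm_mem perm_l) => /(allP l_sqr)/eqP.
- move=> a b lt_ab; rewrite /sign_rel lt_ab andbT -val_eqE (gtn_eqF lt_ab) orbF.
  have /eqP-> : g a * g b == (-1) ^+ c * (g b * g a).
    by apply: (elimT (pairwiseP x0) l'_pair a b) => //; rewrite inE sz_l'.
  by rewrite mulrA -signr_addb addbb mul1r.
- apply: generates_eq_mem l_gen => x.
  have -> : codom g = map snd l'.
    by rewrite codomE -[l' in RHS](mkseq_nth x0) sz_l' /mkseq -val_enum_ord -!map_comp.
  exact/esym/perm_mem/perm_map.
Qed.

Lemma sign_clifford_system c p q : exists2 l : seq (bool * sign_clifford c p q),
  mono_system c l & map fst l = nseq p false ++ nseq q true.
Proof.
rewrite sign_cliffordE; set beta := sign_rel c p q.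
pose e (a : 'I_(p + q)) := ((p <= a)%N, gen F beta a).
exists (map e (enum 'I_(p + q))); last first.
  rewrite -map_comp (eq_map (_ : _ =1 (leq p) \o val)) // map_comp val_enum_ord.
  have const_map b m k : (forall i, (m <= i < m + k)%N -> (p <= i)%N = b) ->
      map (leq p) (iota m k) = nseq k b.
    move=> mkb; rewrite -[k in RHS](size_iota m) -(size_map (leq p)).
    apply/all_pred1P/allP => _ /mapP[i i_mk ->]; rewrite mem_iota in i_mk.
    by rewrite /= mkb.
  rewrite iotaD map_cat; congr (_ ++ _); apply: const_map => i /andP[] //.
  by rewrite [(p <= i)%N]leqNgt add0n => _ ->.
have beta_lt (a b : 'I_(p + q)) : (a < b)%N -> ~~ beta a b.
  move=> lt_ab; rewrite /beta /sign_rel -val_eqE (ltn_eqF lt_ab) orbF.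
  by rewrite ltnNge ltnW ?andbF.
split.
- apply/allP=> _ /mapP[a _ ->] /=; rewrite [_ * _]gen_sqr /beta /sign_rel ltnn andbF.
  by rewrite eqxx.
- have: pairwise ltn (map val (enum 'I_(p + q))).
    by rewrite val_enum_ord -sorted_pairwise ?iota_ltn_sorted //; apply: ltn_trans.
  rewrite !pairwise_map; apply: sub_pairwise => a b /= lt_ab.
  rewrite [_ * gen _ _ b]gen_swap (negPf (beta_lt _ _ lt_ab)) /beta /sign_rel lt_ab.
  by rewrite -val_eqE (gtn_eqF lt_ab) orbF andbT.
(* Every element is a linear combination of monomials, and these are products of generators. *)
- move=> P P1 PL PM Pgen u.
  have P0 : P 0 by rewrite -(addNr 1) -scaleN1r; apply: PL.
  have PD x y : P x -> P y -> P (x + y) by rewrite -{2}[x]scale1r; apply: PL.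
  rewrite [u]mono_decomp; elim/big_ind: _ => // S _.
  rewrite -[_ *: _]addr0; apply: PL => //; rewrite mono_prod //.
  elim/big_ind: _ => // a _; apply: Pgen; apply/mapP; exists (e a) => //.
  by apply: (map_f e); rewrite mem_enum.
Qed.

(** The twist by [w] is undone on the left: z ⊗ 1 is generated by the first family, and (z ⊗ 1)(w ⊗
    h) = 1 ⊗ h. *)
Lemma generates_tensor A B (gs : seq B) (hs : seq A) (w z : B) :
  generates gs -> generates hs -> z * w = 1 ->
  generates ([seq (g *t 1 : tensor B A) | g <- gs] ++
             [seq (w *t h : tensor B A) | h <- hs]).
Proof.
move=> gen_gs gen_hs zw1 P P1 PL PM Pgen.
have PB b : P (b *t 1).
  apply: (gen_gs (fun b => P (b *t 1))) => // [k x y Px Py|x y Px Py|x x_gs].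
  - by rewrite pure_tensorDl pure_tensorZl; apply: PL.
  - by rewrite -[1]mulr1 -tensorM; apply: PM.
  - by apply: Pgen; rewrite mem_cat (map_f (fun g => g *t 1)).
have PA a : P (1 *t a).
  apply: (gen_hs (fun a => P (1 *t a))) => // [k x y Px Py|x y Px Py|x x_hs].
  - by rewrite pure_tensorDr pure_tensorZr; apply: PL.
  - by rewrite -[1]mulr1 -tensorM; apply: PM.
  - rewrite -zw1 -[x]mul1r -tensorM; apply: PM => //.
    by apply: Pgen; rewrite mem_cat (map_f (fun h => w *t h)) ?orbT.
elim/tensor_ind=> [u v Pu Pv|b a]; first by rewrite -[u]scale1r; apply: PL.
by rewrite -[b]mulr1 -[a]mul1r -tensorM; apply: PM.
Qed.

End MonomialSystems.

(** * Generating systems inside tensor products *)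

Section CliffordTensors.
Variable F : fieldType.
Implicit Types (A B : falgType F) (c : bool) (p q : nat).

Lemma pure_tensorNl A B (b : B) (a : A) : (- b) *t a = - (b *t a) :> tensor B A.
Proof. by rewrite -scaleN1r pure_tensorZl [LHS]scaleN1r. Qed.

Lemma pure_tensorNr A B (b : B) (a : A) : b *t (- a) = - (b *t a) :> tensor B A.
Proof. by rewrite -scaleN1r pure_tensorZr [LHS]scaleN1r. Qed.

Lemma comm_tensor_system A B (l0 : seq (bool * B)) (l : seq (bool * A)) :
  mono_system false l0 -> mono_system false l ->
  mono_system false ([seq (x.1, x.2 *t 1 : tensor B A) | x <- l0] ++
                     [seq (x.1, 1 *t x.2 : tensor B A) | x <- l]).
Proof.
case=> sqr0 pair0 gen0 [sqr1 pair1 gen1]; split.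
- rewrite all_cat !all_map; apply/andP; split.
    apply: sub_all sqr0 => -[b x] /= /eqP sqr_x; rewrite tensorM mulr1 sqr_x.
    by case: (b); rewrite ?pure_tensorNl.
  apply: sub_all sqr1 => -[b x] /= /eqP sqr_x; rewrite tensorM mulr1 sqr_x.
  by case: (b); rewrite ?pure_tensorNr.
- rewrite pairwise_cat !pairwise_map; apply/and3P; split.
  + apply/allrelP=> _ _ /mapP[x _ ->] /mapP[y _ ->] /=.
    by rewrite mul1r !tensorM !mulr1 !mul1r.
  + apply: sub_pairwise pair0 => x y /= /eqP xy.
    by rewrite !tensorM xy !mul1r.
  + apply: sub_pairwise pair1 => x y /= /eqP xy.
    by rewrite !tensorM xy !mul1r.
- rewrite map_cat -!map_comp.
  have := generates_tensor gen0 gen1 (mulr1 1).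
  by rewrite -!map_comp.
Qed.

(** With x, y the two generators of B, the product w = xy anticommutes with both, so w ⊗ z
    anticommutes with x ⊗ 1 and y ⊗ 1. As w^2 = -x^2 y^2, the signs of the remaining generators flip
    exactly when x^2 = y^2. *)
Lemma anti_tensor_system A B (u v : bool * B) (l : seq (bool * A)) :
  mono_system true [:: u; v] -> mono_system true l ->
  mono_system true
    [:: (u.1, u.2 *t 1 : tensor B A), (v.1, v.2 *t 1 : tensor B A)
      & [seq (~~ (u.1 (+) v.1) (+) x.1, (u.2 * v.2) *t x.2 : tensor B A) | x <- l]].
Proof.
case: u v => [b1 x] [b2 y] [/= /and3P[/eqP sqr_x /eqP sqr_y _]].
rewrite !andbT => /eqP xy gen0 [sqr1 pair1 gen1]; rewrite mulN1r in xy.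
set w := x * y.
have yx : y * x = - w by rewrite /w xy opprK.
have xw : x * w = - (w * x) by rewrite -mulrA yx mulrN opprK.
have yw : y * w = - (w * y) by rewrite mulrA yx mulNr.
have sqr_w : w * w = (-1) ^+ (~~ (b1 (+) b2)).
  rewrite -[LHS]mulrA yw mulrN mulrA mulrA sqr_x -mulrA sqr_y -signr_addb.
  by case: (b1 (+) b2); rewrite ?opprK.
split.
- rewrite /= all_map; apply/and3P; split.
  + rewrite tensorM mulr1 sqr_x.
    by case: (b1); rewrite ?pure_tensorNl.
  + rewrite tensorM mulr1 sqr_y.
    by case: (b2); rewrite ?pure_tensorNl.
  + apply: sub_all sqr1 => -[b z] /= /eqP sqr_z.
    rewrite tensorM sqr_w sqr_z signr_addb.
    by case: (~~ _); case: (b); rewrite /= ?(pure_tensorNl, pure_tensorNr);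
      rewrite !(mulr1, mul1r, mulN1r).
- rewrite !pairwise_cons /= !all_map; apply/and3P; split.
  + rewrite !tensorM xy mulN1r pure_tensorNl mulr1 eqxx /=.
    by apply/allP=> z _ /=; rewrite !tensorM xw mulr1 mul1r mulN1r pure_tensorNl.
  + by apply/allP=> z _ /=; rewrite !tensorM yw mulr1 mul1r mulN1r pure_tensorNl.
  + rewrite pairwise_map; apply: sub_pairwise pair1 => z t /= /eqP zt.
    by rewrite !tensorM zt !mulN1r pure_tensorNr.
(* Since w^2 is 1 or -1, the inverse of w is w up to that sign. *)
- have zw1 : ((-1) ^+ (~~ (b1 (+) b2)) * w) * w = 1.
    by rewrite -mulrA sqr_w -signr_addb addbb.
  have := generates_tensor gen0 gen1 zw1.
  by rewrite /= -!map_comp.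
Qed.

End CliffordTensors.

(** * Splitting rules and isomorphisms for few generators *)

Section CliffordIsomorphisms.
Variable F : fieldType.
Implicit Types (A B : falgType F) (c : bool) (p q : nat).

Local Notation "A ≃ B" := (alg_iso A B) (at level 70).
Local Notation "A ⊗ B" := (tensor A B) (at level 40, left associativity).
Local Notation Cl := (clifford F).
Local Notation K := (comm_clifford F).

(** Replacing y by xy keeps a system: (xy)^2 = (-1)^c x^2 y^2, and y is recovered from x(xy) up to
    the sign of x^2. *)
Lemma mono_system_mulr c A (u v : bool * A) : mono_system c [:: u; v] ->
  mono_system c [:: u; (c (+) u.1 (+) v.1, u.2 * v.2)].
Proof.
case: u v => [b1 x] [b2 y] [/= /and3P[/eqP sqr_x /eqP sqr_y _]].
rewrite !andbT => /eqP xy gen_xy.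
have yx : y * x = (-1) ^+ c * (x * y) by rewrite xy mulrA -signr_addb addbb mul1r.
split=> /=.
- rewrite sqr_x eqxx andbT /= -[X in X == _]mulrA (mulrA y) yx -!mulrA sqr_y.
  rewrite mulr_sign; case: (c); rewrite ?mulrN mulrA sqr_x -signr_addb /=.
    by case: (b1); case: (b2); rewrite /= ?opprK eqxx.
  by rewrite eqxx.
- rewrite !andbT -mulrA yx; case: (c); last by rewrite !mul1r eqxx.
  by rewrite !mulN1r mulrN opprK eqxx.
- move=> P P1 PL PM Pgen; apply: gen_xy => // z.
  have Px : P x by apply: Pgen; rewrite !inE eqxx.
  rewrite !inE => /orP[/eqP-> // | /eqP->].
  have -> : y = (-1) ^+ b1 *: (x * (x * y)) + 0.
    by rewrite mulrA sqr_x addr0 mulr_sign scaler_sign; case: (b1); rewrite ?opprK.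
  apply: (PL); last by rewrite -(addNr 1) -scaleN1r; apply: PL.
  by apply: PM => //; apply: Pgen; rewrite !inE eqxx orbT.
Qed.

Lemma clifford_system p q : exists2 l : seq (bool * Cl p q),
  mono_system true l & map fst l = nseq p false ++ nseq q true.
Proof. exact: (sign_clifford_system F true). Qed.

Lemma comm_clifford_system p q : exists2 l : seq (bool * K p q),
  mono_system false l & map fst l = nseq p false ++ nseq q true.
Proof. exact: (sign_clifford_system F false). Qed.

Lemma clifford_iso A (l : seq (bool * A)) p q : mono_system true l ->
  count negb (map fst l) = p -> count id (map fst l) = q ->
  \dim {:A} = (2 ^ (p + q))%N -> A ≃ Cl p q.
Proof. by move=> *; apply/alg_iso_sym/(@mono_system_iso F true A l). Qed.

Lemma comm_clifford_iso A (l : seq (bool * A)) p q : mono_system false l ->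
  count negb (map fst l) = p -> count id (map fst l) = q ->
  \dim {:A} = (2 ^ (p + q))%N -> A ≃ K p q.
Proof. by move=> *; apply/alg_iso_sym/(@mono_system_iso F false A l). Qed.

Lemma comm_clifford_tensor p0 q0 p q : K p0 q0 ⊗ K p q ≃ K (p0 + p) (q0 + q).
Proof.
have [l0 sys0 sgn0] := comm_clifford_system p0 q0.
have [l sys sgn] := comm_clifford_system p q.
have sgnE : [seq x.1 | x <- [seq (x.1, x.2 *t 1 : K p0 q0 ⊗ K p q) | x <- l0] ++
                     [seq (x.1, 1 *t x.2 : K p0 q0 ⊗ K p q) | x <- l]] =
  nseq p0 false ++ nseq q0 true ++ nseq p false ++ nseq q true.
  by rewrite map_cat -!map_comp -sgn catA -sgn0.
apply: (comm_clifford_iso (comm_tensor_system sys0 sys)).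
- by rewrite sgnE !count_cat !count_nseq /= !(mul0n, mul1n, addn0, add0n).
- by rewrite sgnE !count_cat !count_nseq /= !(mul0n, mul1n, addn0, add0n).
- by rewrite dim_tensorE !dim_comm_clifford -expnD addnACA.
Qed.

(** For q0 = 1 the two generators of the first factor have opposite squares and the signs of the
    second factor survive; for q0 = 0 or 2 they are all flipped, which exchanges p and q. *)
Lemma clifford_tensor p0 q0 p q : (p0 + q0)%N = 2 ->
  Cl p0 q0 ⊗ Cl p q ≃
  if q0 == 1 then Cl (p0 + p) (q0 + q) else Cl (p0 + q) (q0 + p).
Proof.
move=> dim2.
have sign2 b1 b2 : [:: b1; b2] = nseq p0 false ++ nseq q0 true ->
    ~~ (b1 (+) b2) = (q0 != 1).
  by case: p0 q0 dim2 => [|[|[|?]]] [|[|[|?]]] //= _ [-> ->].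
have [l0 sys0 sgn0] := clifford_system p0 q0.
have [l sys sgn] := clifford_system p q.
have sz_l0 : size l0 = 2 by rewrite -(size_map fst) sgn0 size_cat !size_nseq.
case: l0 => [//|u [//|v [|//]]] in sys0 sgn0 sz_l0 *.
set s := ~~ (u.1 (+) v.1); set w := u.2 * v.2.
have sgnE : [seq x.1 | x <-
    [:: (u.1, u.2 *t 1 : Cl p0 q0 ⊗ Cl p q), (v.1, v.2 *t 1 : Cl p0 q0 ⊗ Cl p q)
      & [seq (s (+) x.1, w *t x.2 : Cl p0 q0 ⊗ Cl p q) | x <- l]]] =
  (nseq p0 false ++ nseq q0 true) ++ nseq p s ++ nseq q (~~ s).
  rewrite -sgn0 /= -map_comp (eq_map (_ : _ =1 addb s \o fst)) // map_comp sgn.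
  by rewrite map_cat !map_nseq addbF addbT.
have sE : s = (q0 != 1) := sign2 _ _ sgn0.
have dimE : \dim {:Cl p0 q0 ⊗ Cl p q} = (2 ^ (p0 + q0 + (p + q)))%N.
  by rewrite dim_tensorE !dim_clifford -expnD.
case: ifP => q01; apply: (clifford_iso (anti_tensor_system sys0 sys)).
- rewrite sgnE sE q01 !count_cat !count_nseq /=. lia.
- rewrite sgnE sE q01 !count_cat !count_nseq /=; lia.
- by rewrite dimE; congr (2 ^ _)%N; lia.
- rewrite sgnE sE q01 !count_cat !count_nseq /=; lia.
- rewrite sgnE sE q01 !count_cat !count_nseq /=; lia.
- by rewrite dimE; congr (2 ^ _)%N; lia.
Qed.

(** In Cl(1,1), with x^2 = 1 and y^2 = -1, the product xy squares to 1, so x and xy form a system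
    for Cl(2,0). *)
Lemma clifford11_20 : Cl 2 0 ≃ Cl 1 1.
Proof.
have [l sys sgn] := clifford_system 1 1.
case: l => [//|u [//|v [|//]]] in sys sgn *; case: sgn => u1 v1.
apply/alg_iso_sym/(clifford_iso (mono_system_mulr sys)); rewrite /= ?u1 ?v1 //.
exact: dim_clifford.
Qed.

Lemma comm_clifford0 : K 0 0 ≃ Cl 0 0.
Proof.
have [[|//] [? ? ?] _] := comm_clifford_system 0 0.
by apply: (@clifford_iso _ [::]) => //; apply: dim_comm_clifford.
Qed.

(** A single generator has no partner to commute or anticommute with. *)
Lemma comm_clifford1 p q : (p + q)%N = 1 -> K p q ≃ Cl p q.
Proof.
move=> dim1; have [l [sqr_l pair_l gen_l] sgn] := comm_clifford_system p q.
apply: (@clifford_iso _ l); last exact: dim_comm_clifford.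
- have: size l = 1 by rewrite -(size_map fst) sgn size_cat !size_nseq.
  by case: l => [|x [|]] // in sqr_l pair_l gen_l sgn *.
- by rewrite sgn count_cat !count_nseq mul1n mul0n addn0.
- by rewrite sgn count_cat !count_nseq mul1n mul0n.
Qed.

(** Both sides are K(1,1): the product of two commuting square roots of -1 squares to 1. *)
Lemma clifford01_10 : Cl 0 1 ⊗ Cl 1 0 ≃ Cl 0 1 ⊗ Cl 0 1.
Proof.
have K_Cl01 := comm_clifford1 (erefl : 0 + 1 = 1)%N.
have K_Cl10 := comm_clifford1 (erefl : 1 + 0 = 1)%N.
apply: (alg_iso_trans (alg_iso_sym (tensor_congr K_Cl01 K_Cl10))).
apply: alg_iso_trans (tensor_congr K_Cl01 K_Cl01).
apply: (alg_iso_trans (comm_clifford_tensor _ _ _ _)).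
have [l sys sgn] := comm_clifford_system 0 1.
case: l => [//|u [|//]] in sys sgn *; case: sgn => u1.
have := mono_system_mulr (comm_tensor_system sys sys); move/comm_clifford_iso.
move/(_ 1 1)%N=> /= iso; apply/alg_iso_sym/iso; rewrite ?u1 //.
by rewrite dim_tensorE !dim_comm_clifford.
Qed.
#[local] Hint Resolve alg_iso_refl : core.

Lemma tensor_unit A : A ⊗ Cl 0 0 ≃ A.
Proof.
apply/alg_iso_sym/(surj_alg_iso (alg_mor_tensorl A (Cl 0 0))).
  by rewrite dim_tensorE dim_clifford muln1.
have scal (u : Cl 0 0) : exists k, u = k *: 1.
  have [[|//] [_ _ gen0] _] := clifford_system 0 0.
  apply: (gen0 (fun u => exists k, u = k *: 1)) => //.
  - by exists 1; rewrite scale1r.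
  - by move=> k _ _ [a ->] [b ->]; exists (k * a + b); rewrite scalerDl scalerA.
  - by move=> _ _ [a ->] [b ->]; exists (a * b); rewrite -scalerAl mul1r scalerA.
elim/tensor_ind=> [_ _ [a <-] [b <-]|a u].
  by exists (a + b); rewrite pure_tensorDl.
by have [k ->] := scal u; exists (k *: a); rewrite pure_tensorZl pure_tensorZr.
Qed.

(** With [tensor_proper], this lets isomorphisms be used by [rewrite] inside tensor products. *)
#[local] Instance alg_iso_equiv : Equivalence (@alg_iso F).
Proof.
split; [exact: alg_iso_refl | exact: alg_iso_sym |].
by move=> A B C; apply: alg_iso_trans.
Qed.

#[local] Instance tensor_proper :
  Proper (@alg_iso F ==> @alg_iso F ==> @alg_iso F) (@tensor F).
Proof. by move=> A A' isoA B B' isoB; apply: tensor_congr. Qed.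

(** * Normal forms of Cl(p,q) according to p - q mod 8 *)

Local Notation X := (Cl 1 1).
Local Notation Y := (Cl 0 2).
Local Notation D := (Cl 1 0).
Local Notation C := (Cl 0 1).

Lemma tensor_CA A B E : A ⊗ (B ⊗ E) ≃ B ⊗ (A ⊗ E).
Proof. by rewrite tensor_assoc (tensor_comm A B) -tensor_assoc. Qed.

(** The case M = 0 needs [tensor_unit], because the first power is the algebra itself and carries no
    unit factor. *)
Lemma clifford_powS p q M :
  clifford_pow F p q M.+1 ≃ Cl p q ⊗ clifford_pow F p q M.
Proof. by case: M => [|M]; [rewrite tensor_unit | reflexivity]. Qed.

(* Both sides are Cl(2,2). *)
Lemma clifford02_02 : Y ⊗ Y ≃ X ⊗ X.
Proof.
rewrite (@clifford_tensor 0 2 0 2) // (@clifford_tensor 1 1 1 1) //.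
Qed.

(* Both sides are Cl(1,2). *)
Lemma clifford01_02 : C ⊗ Y ≃ C ⊗ X.
Proof.
rewrite !(tensor_comm C) (@clifford_tensor 0 2 0 1) // (@clifford_tensor 1 1 0 1) //.
Qed.

(* [t] stands for p - q mod 8 and [N] for the integer part of (p + q) / 2; at
   [N = 0] the values for [t] in 4, 5, 6 are junk. *)
Definition clifford_nf t N : falgType F :=
  match t with
  | 0 | 2 => clifford_pow F 1 1 N
  | 4 | 6 => Y ⊗ clifford_pow F 1 1 N.-1
  | 1 => D ⊗ clifford_pow F 1 1 N
  | 5 => D ⊗ (Y ⊗ clifford_pow F 1 1 N.-1)
  | _ => C ⊗ clifford_pow F 1 1 N
  end.

(** Adjoining Cl(1,1) keeps t, while adjoining Cl(2,0) sends t to 2 - t mod 8. The normal form takes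
    the same shape at t and 2 - t, so both amount to one more factor X. *)
Lemma X_nf t t' N : (t < 8)%N -> (t' < 8)%N -> t = t' \/ ((t + t') %% 8)%N = 2 ->
  (t \in [:: 4; 5; 6] -> 0 < N)%N ->
  X ⊗ clifford_nf t N ≃ clifford_nf t' N.+1.
Proof.
have XN M : X ⊗ clifford_pow F 1 1 M ≃ clifford_pow F 1 1 M.+1.
  by rewrite clifford_powS.
have AXN A M : X ⊗ (A ⊗ clifford_pow F 1 1 M) ≃ A ⊗ clifford_pow F 1 1 M.+1.
  by rewrite tensor_CA (XN M).
have ABXN A B M : X ⊗ (A ⊗ (B ⊗ clifford_pow F 1 1 M)) ≃
    A ⊗ (B ⊗ clifford_pow F 1 1 M.+1).
  by rewrite tensor_CA (AXN B M).
do 8?[case: t => [|t]] => //; do 8?[case: t' => [|t']] => //= _ _ tt' Ngt0;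
  case: tt' => // _;
  try (case: N Ngt0 => [/(_ isT) //|N _ /=]);
  by [apply: XN | apply: AXN | apply: ABXN].
Qed.

(** Adjoining Cl(0,2) sends t to -t - 2 mod 8. A second Y turns the pair into two factors X, and
    next to C a single Y turns into X. *)
Lemma Y_nf t t' N : (t < 8)%N -> (t' < 8)%N -> ((t + t' + 2) %% 8)%N = 0 ->
  (t \in [:: 4; 5; 6] -> 0 < N)%N ->
  Y ⊗ clifford_nf t N ≃ clifford_nf t' N.+1.
Proof.
have YYN M : Y ⊗ (Y ⊗ clifford_pow F 1 1 M) ≃ clifford_pow F 1 1 M.+2.
  by rewrite tensor_assoc clifford02_02 !clifford_powS -tensor_assoc.
have DYYN M : Y ⊗ (D ⊗ (Y ⊗ clifford_pow F 1 1 M)) ≃ D ⊗ clifford_pow F 1 1 M.+2.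
  by rewrite tensor_CA (YYN M).
have CYN M : Y ⊗ (C ⊗ clifford_pow F 1 1 M) ≃ C ⊗ clifford_pow F 1 1 M.+1.
  by rewrite tensor_CA clifford_powS !tensor_assoc clifford01_02.
do 8?[case: t => [|t]] => //; do 8?[case: t' => [|t']] => //= _ _ tt' Ngt0;
  move: tt' => // _;
  try (case: N Ngt0 => [/(_ isT) //|N _ /=]);
  by [apply: alg_iso_refl | apply: YYN | apply: DYYN | apply: CYN | apply: tensor_CA].
Qed.

(** Strong induction on p + q, removing two generators at a time: Cl(1,1) if both signs occur,
    otherwise Cl(0,2), or Cl(2,0) read as Cl(1,1). The residue of p - q is written p + 7q to stay in
    the natural numbers. *)
Lemma clifford_iso_nf p q :
  Cl p q ≃ clifford_nf ((p + 7 * q) %% 8)%N ((p + q) %/ 2)%N.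
Proof.
have [n] := ubnP (p + q)%N; elim: n => // n IHn in p q *; rewrite ltnS => le_n.
case: p q => [|p] [|q] in le_n *.
- exact: alg_iso_refl.
- case: q => [|q] in le_n *; first by rewrite /= tensor_unit.
  have Y_Cl : Cl 0 q.+2 ≃ Y ⊗ Cl q 0 by rewrite (@clifford_tensor 0 2 q 0).
  rewrite Y_Cl (IHn q 0) ?addn0; last by lia.
  have -> : ((0 + q.+2) %/ 2 = (q %/ 2).+1)%N by lia.
  apply: Y_nf; rewrite ?ltn_pmod // ?inE; lia.
- case: p => [|p] in le_n *; first by rewrite /= tensor_unit.
  have X_Cl : Cl p.+2 0 ≃ X ⊗ Cl 0 p.
    by rewrite -clifford11_20 (@clifford_tensor 2 0 0 p).
  rewrite X_Cl (IHn 0 p); last by lia.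
  have -> : ((p.+2 + 0) %/ 2 = ((0 + p) %/ 2).+1)%N by lia.
  apply: X_nf; rewrite ?ltn_pmod // ?inE; last by lia.
  by right; lia.
- have X_Cl : Cl p.+1 q.+1 ≃ X ⊗ Cl p q by rewrite (@clifford_tensor 1 1 p q).
  rewrite X_Cl (IHn p q); last by lia.
  have -> : ((p.+1 + q.+1) %/ 2 = ((p + q) %/ 2).+1)%N by lia.
  apply: X_nf; rewrite ?ltn_pmod // ?inE; last by lia.
  by left; lia.
Qed.

(** * The commutative factor K(r,s) and absorption by Cl(0,1) *)

Lemma comm_clifford_iso_pow r : K r 0 ≃ clifford_pow F 1 0 r.
Proof.
elim: r => [|r IHr]; first exact: comm_clifford0.
have K_D := @comm_clifford1 1 0 erefl.
by rewrite clifford_powS -IHr -K_D (comm_clifford_tensor 1 0 r 0).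
Qed.

(** Induction on r from s copies of C; each further D becomes a C next to one already present. *)
Lemma comm_clifford_iso_powC r s : (0 < s)%N -> K r s ≃ clifford_pow F 0 1 (r + s).
Proof.
have K_C := @comm_clifford1 0 1 erefl; have K_D := @comm_clifford1 1 0 erefl.
case: s => // s _; elim: r => [|r IHr].
  elim: s => [|s IHs]; first exact: K_C.
  by rewrite clifford_powS -IHs -K_C (comm_clifford_tensor 0 1 0 s.+1).
have KS : K r.+1 s.+1 ≃ K 1 0 ⊗ K r s.+1 by rewrite (comm_clifford_tensor 1 0 r s.+1).
rewrite KS IHr K_D addSn addnS !clifford_powS !tensor_assoc.
by rewrite (tensor_comm D) clifford01_10.
Qed.

(** One C from the power turns Y into X and D into C. For odd t the normal form has exactly one
    factor C or D, which accounts for the exponent M + [odd t]. *)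
Lemma clifford01_absorb_nf t N M :
  (t < 8)%N -> (t \in [:: 4; 5; 6] -> 0 < N)%N -> (0 < M)%N ->
  clifford_pow F 0 1 M ⊗ clifford_nf t N ≃
  clifford_pow F 0 1 (M + odd t) ⊗ clifford_pow F 1 1 N.
Proof.
move=> t8 Ngt0; case: M => // M _.
have CEY E N' : (C ⊗ E) ⊗ (Y ⊗ clifford_pow F 1 1 N') ≃
    (C ⊗ E) ⊗ clifford_pow F 1 1 N'.+1.
  by rewrite clifford_powS !(tensor_comm C) -!(tensor_assoc E) !(tensor_assoc C);
     rewrite clifford01_02.
have CED E Z : (C ⊗ E) ⊗ (D ⊗ Z) ≃ (C ⊗ (C ⊗ E)) ⊗ Z.
  by rewrite !tensor_assoc -clifford01_10 -!tensor_assoc (tensor_CA E D).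
have CEC E Z : (C ⊗ E) ⊗ (C ⊗ Z) ≃ (C ⊗ (C ⊗ E)) ⊗ Z.
  by rewrite -!tensor_assoc (tensor_CA E C).
have M0 : (M.+1 + 0 = M.+1)%N by rewrite addn0.
have M1 : (M.+1 + 1 = M.+2)%N by rewrite addn1.
do 8?[case: t => [|t] in t8 Ngt0 *] => //;
  rewrite [odd _]/= [clifford_nf _ _]/= ?M0 ?M1 !(clifford_powS 0 1) //.
(* The remaining residues 4, 5, 6 are those whose normal form contains Y. *)
- by case: N Ngt0 => [/(_ isT) //|N _]; apply: CEY.
- by case: N Ngt0 => [/(_ isT) //|N _]; rewrite CED; apply: CEY.
- by case: N Ngt0 => [/(_ isT) //|N _]; apply: CEY.
Qed.

Lemma clifford10_pow_01 r : clifford_pow F 1 0 r ⊗ C ≃ clifford_pow F 0 1 r.+1.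
Proof.
have K_C := @comm_clifford1 0 1 erefl.
rewrite -comm_clifford_iso_pow -K_C (comm_clifford_tensor r 0 0 1) addn0.
by have := @comm_clifford_iso_powC r 1 isT; rewrite (addn1 r).
Qed.

End CliffordIsomorphisms.

(** * The five cases, by r, s and p - q mod 8 *)

Theorem theorem1 (R : realType) (r s p q : nat) :
  let m := (r + s)%N in
  let n := (p + q)%N in
  let N := (n %/ 2)%N in
  let sigma := (n - 2 * N)%N in
  let M := (m + sigma)%N in
  let t := ((p%:Z - q%:Z) %% 8%:Z)%Z in
  [/\ (* I *)
      r = 0%N -> s = 0%N -> t = 0%:Z \/ t = 2%:Z ->
        alg_iso (ext_clifford R r s p q) (clifford_pow R 1 1 N),
      (* II *)
      r = 0%N -> s = 0%N -> t = 4%:Z \/ t = 6%:Z ->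
        (1 <= N)%N /\
        alg_iso (ext_clifford R r s p q)
          (tensor (clifford R 0 2) (clifford_pow R 1 1 (N - 1)%N)),
      (* III *)
      (1 <= s)%N \/ (s = 0%N /\ (t = 3%:Z \/ t = 7%:Z)) ->
        alg_iso (ext_clifford R r s p q)
          (tensor (clifford_pow R 0 1 M) (clifford_pow R 1 1 N)),
      (* IV *)
      (s = 0%N /\ t = 1%:Z) \/
      ((1 <= r)%N /\ s = 0%N /\ (t = 0%:Z \/ t = 2%:Z)) ->
        alg_iso (ext_clifford R r s p q)
          (tensor (clifford_pow R 1 0 M) (clifford_pow R 1 1 N))
    & (* V *)
      (s = 0%N /\ t = 5%:Z) \/
      ((1 <= r)%N /\ s = 0%N /\ (t = 4%:Z \/ t = 6%:Z)) ->
        (1 <= N)%N /\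
        alg_iso (ext_clifford R r s p q)
          (tensor (tensor (clifford_pow R 1 0 M) (clifford R 0 2))
                  (clifford_pow R 1 1 (N - 1)%N))].
Proof.
move=> m n N sigma M t; pose u := ((p + 7 * q) %% 8)%N.
have tE : t = u%:Z by rewrite /t /u; lia.
have u8 : (u < 8)%N by rewrite ltn_pmod.
(* The numbers p + q and p - q have the same parity, and reduction mod 8 preserves it. *)
have sigmaE : sigma = odd u by rewrite /sigma /N /n /u; lia.
(* These residues force |p - q| to be at least 2, which rules out the junk values of
   [clifford_nf]. *)
have Ngt0 : (u \in [:: 4; 5; 6] -> 0 < N)%N by rewrite /N /n /u !inE; lia.
have ext_iso A : alg_iso (comm_clifford R r s) A ->
    alg_iso (ext_clifford R r s p q) (tensor A (clifford_nf R u N)).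
  by move=> isoA; apply: tensor_congr isoA (clifford_iso_nf R p q).
have unitl A : alg_iso (tensor (clifford R 0 0) A) A.
  exact: alg_iso_trans (tensor_comm _ _) (tensor_unit A).
have ext0 : r = 0%N -> s = 0%N ->
    alg_iso (ext_clifford R r s p q) (clifford_nf R u N).
  move=> r0 s0; apply: alg_iso_trans (unitl _); apply: ext_iso.
  by rewrite r0 s0; apply: comm_clifford0.
have extD : s = 0%N ->
    alg_iso (ext_clifford R r s p q)
      (tensor (clifford_pow R 1 0 r) (clifford_nf R u N)).
  by move=> s0; apply: ext_iso; rewrite s0; apply: comm_clifford_iso_pow.
have inj_t k : t = k%:Z -> u = k by rewrite tE => -[].
rewrite subn1; split.
- by move=> r0 s0 ut; have := ext0 r0 s0; case: ut => /inj_t->.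
- move=> r0 s0 ut; have := ext0 r0 s0; case: ut => /inj_t u_eq.
    by rewrite u_eq; split=> //; apply: Ngt0; rewrite u_eq.
  by rewrite u_eq; split=> //; apply: Ngt0; rewrite u_eq.
- case=> [s_gt0|[s0 ut]].
    apply: alg_iso_trans (ext_iso _ (comm_clifford_iso_powC R r s_gt0)) _.
    by rewrite /M sigmaE; apply: clifford01_absorb_nf => //;
       rewrite addn_gt0 s_gt0 orbT.
  (* Here the C comes from the normal form of Cl(p,q) and turns the r copies of D into copies of
     C. *)
  apply: alg_iso_trans (extD s0) _.
  have -> : M = r.+1.
    by rewrite /M /m sigmaE s0 addn0; case: ut => /inj_t->; rewrite addn1.
  have -> : clifford_nf R u N = tensor (clifford R 0 1) (clifford_pow R 1 1 N).
    by case: ut => /inj_t->.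
  apply: alg_iso_trans (tensor_assoc _ _ _) _.
  exact: tensor_congr (clifford10_pow_01 R r) (alg_iso_refl _).
- move=> ut; have s0 : s = 0%N by case: ut => -[] // _ [].
  apply: alg_iso_trans (extD s0) _.
  case: ut => [[_ /inj_t u_eq]|[_ [_ ut]]].
    (* For t = 1 the D of the normal form joins the r copies coming from K(r,0). *)
    have -> : M = r.+1 by rewrite /M /m sigmaE s0 addn0 u_eq addn1.
    rewrite u_eq; apply: alg_iso_trans (tensor_assoc _ _ _) _.
    apply: tensor_congr (alg_iso_refl _); apply: alg_iso_trans (tensor_comm _ _) _.
    exact/alg_iso_sym/clifford_powS.
  have -> : M = r.
    by rewrite /M /m sigmaE s0 addn0; case: ut => /inj_t->; rewrite addn0.
  by case: ut => /inj_t->; apply: alg_iso_refl.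
- move=> ut; have s0 : s = 0%N by case: ut => -[] // _ [].
  split.
    by apply: Ngt0; case: ut => [[_ /inj_t->]|[_ [_ [] /inj_t->]]].
  apply: alg_iso_trans (extD s0) _.
  case: ut => [[_ /inj_t u_eq]|[_ [_ ut]]].
    have -> : M = r.+1 by rewrite /M /m sigmaE s0 addn0 u_eq addn1.
    rewrite u_eq; apply: alg_iso_trans (tensor_assoc _ _ _) _.
    apply: alg_iso_trans (tensor_assoc _ _ _) _.
    apply: tensor_congr (alg_iso_refl _); apply: tensor_congr (alg_iso_refl _).
    apply: alg_iso_trans (tensor_comm _ _) _; exact/alg_iso_sym/clifford_powS.
  (* For even t the normal form has no D to contribute, and only reassociation remains. *)
  have -> : M = r.
    by rewrite /M /m sigmaE s0 addn0; case: ut => /inj_t->; rewrite addn0.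
  by case: ut => /inj_t->; apply: tensor_assoc.
Qed.
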